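(* Let $\ell$ be a prime and let $f(\zeta)$ be a symmetric Laurent polynomial that is divisible by $\Phi_\ell(\zeta^2)$ and such that $[\zeta^{m-1}]f(\zeta)\ge[\zeta^{m+1}]f(\zeta)$ for all integers $m\ge 1$. Then $$\frac{\zeta^{\ell-1}f(\zeta)}{\Phi_\ell(\zeta^2)}$$ is a symmetric Laurent polynomial with non-negative coefficients.
   Context: Laurent polynomials have rational coefficients, i.e. lie in $\mathbb{Q}[\zeta^{-1},\zeta]$. For a prime $\ell$, $\Phi_\ell(\zeta):=1+\zeta+\cdots+\zeta^{\ell-1}$. ''Divisible by $\Phi_\ell(\zeta^2)$'' means $f(\zeta)=g(\zeta)\Phi_\ell(\zeta^2)$ for some $g(\zeta)\in\mathbb{Q}[\zeta^{-1},\zeta]$. $[\zeta^m]f(\zeta)$ denotes the coefficient of $\zeta^m$ in $f(\zeta)$. A Laurent polynomial $f$ is symmetric if $f(\zeta^{-1})=f(\zeta)$. *)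

(* Defs.v *)
From HB Require Import structures.
From mathcomp Require Import all_boot all_order all_algebra.
From mathcomp Require Import finmap.
From mathcomp.multinomials Require Import monalg.

Set Implicit Arguments.
Unset Strict Implicit.
Unset Printing Implicit Defensive.

Import Order.TTheory GRing.Theory Num.Theory.
Local Open Scope fset_scope.
Local Open Scope ring_scope.

(* Q[zeta^-1, zeta] as the finitely supported functions int -> rat.  The ring
   structure that monalg puts on {malg rat[K]} requires 'K : monomType', which
   excludes monoids with nontrivial units such as (int, +); hence this alias,
   which inherits the additive structure, the coefficients f@_k, the support
   msupp f and the monomials << c *g k >> (that is, c zeta^k), but has its own
   convolution product. *)
Definition laurent : Type := {malg rat[int]}.

HB.instance Definition _ := GRing.Zmodule.on laurent.

Section LaurentRing.

Implicit Types (f g h : laurent) (k m : int) (c : rat).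

Definition lone : laurent := << 1 *g 0 >>.

Definition lmul f g : laurent :=
  \sum_(k1 <- msupp f) \sum_(k2 <- msupp g) << f@_k1 * g@_k2 *g (k1 + k2)%R >>.

Lemma lmulw (d1 d2 : {fset int}) f g :
  msupp f `<=` d1 -> msupp g `<=` d2 ->
  lmul f g = \sum_(k1 <- d1) \sum_(k2 <- d2) << f@_k1 * g@_k2 *g (k1 + k2)%R >>.
Proof.
move=> le_d1 le_d2; rewrite /lmul (big_fset_incl _ le_d1) /=.
  apply/eq_bigr=> k1 _; apply/big_fset_incl => // k _ /mcoeff_outdom ->.
  by rewrite mulr0 monalgU0.
move=> k _ /mcoeff_outdom fk.
by rewrite big1 => // k' _; rewrite fk mul0r monalgU0.
Qed.

Lemma lmulC : commutative lmul.
Proof.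
move=> f g; rewrite /lmul exchange_big /=.
by apply: eq_bigr => k2 _; apply: eq_bigr => k1 _; rewrite mulrC addrC.
Qed.

Lemma lmul0 g : lmul 0 g = 0.
Proof. by rewrite /lmul msupp0 big_seq_fset0. Qed.

Lemma lmulDl : left_distributive lmul +%R.
Proof.
move=> f1 f2 g.
have sg := fsubset_refl (msupp g).
rewrite (lmulw (msuppD_le f1 f2) sg) (lmulw (fsubsetUl _ (msupp f2)) sg).
rewrite (lmulw (fsubsetUr (msupp f1) _) sg) -big_split /=.
apply: eq_bigr => k1 _; rewrite -big_split /=; apply: eq_bigr => k2 _.
by rewrite mcoeffD mulrDl monalgUD.
Qed.

Lemma lmulDr : right_distributive lmul +%R.
Proof. by move=> f g h; rewrite lmulC lmulDl !(lmulC f). Qed.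

Lemma lmulUU c1 c2 k1 k2 :
  lmul << c1 *g k1 >> << c2 *g k2 >> = << c1 * c2 *g (k1 + k2)%R >>.
Proof. by rewrite (lmulw msuppU_le msuppU_le) !big_seq_fset1 !mcoeffUU. Qed.

Lemma lmul_suml (I : Type) (r : seq I) (F : I -> laurent) g :
  lmul (\sum_(i <- r) F i) g = \sum_(i <- r) lmul (F i) g.
Proof.
exact: (big_morph (lmul^~ g) (fun _ _ => lmulDl _ _ _) (lmul0 _)).
Qed.

Lemma lmul_sumr (I : Type) (r : seq I) (F : I -> laurent) g :
  lmul g (\sum_(i <- r) F i) = \sum_(i <- r) lmul g (F i).
Proof. by rewrite lmulC lmul_suml; apply: eq_bigr => i _; rewrite lmulC. Qed.

Lemma lmulA : associative lmul.
Proof.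
have E f g : lmul f g = \sum_(k <- msupp f) lmul << f@_k *g k >> g.
  by rewrite {1}[f]monalgE lmul_suml.
have E' f g : lmul f g = \sum_(k <- msupp g) lmul f << g@_k *g k >>.
  by rewrite {1}[g]monalgE lmul_sumr.
move=> f g h; rewrite E [lmul f g]E lmul_suml; apply: eq_bigr => i _.
rewrite (E g h) (E' _ g) lmul_sumr lmul_suml; apply: eq_bigr => j _.
rewrite [in LHS](E' _ h) lmul_sumr [RHS]E'; apply: eq_bigr => k _.
by rewrite !lmulUU mulrA addrA.
Qed.

Lemma lmul1 : left_id lone lmul.
Proof.
move=> f; rewrite (lmulw msuppU_le (fsubset_refl _)) big_seq_fset1.
rewrite [RHS]monalgE; apply: eq_bigr => k _.
by rewrite mcoeffUU mul1r add0r.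
Qed.

Lemma lone_neq0 : lone != 0.
Proof. by rewrite monalgU_eq0 oner_eq0. Qed.

End LaurentRing.

HB.instance Definition _ := GRing.Zmodule_isComNzRing.Build laurent
  lmulA lmulC lmul1 lmulDl lone_neq0.

Section LaurentTheory.

Implicit Types (f g h : laurent) (k m : int) (c : rat).

Lemma laurentUM c1 c2 k1 k2 :
  (<< c1 *g k1 >> : laurent) * << c2 *g k2 >> = << c1 * c2 *g (k1 + k2)%R >>.
Proof. exact: lmulUU. Qed.

Lemma laurent_coeffM f g m :
  (f * g)@_m = \sum_(k <- msupp f) f@_k * g@_(m - k)%R.
Proof.
rewrite [f * g]/(lmul f g) /lmul raddf_sum; apply: eq_bigr => k _ /=.
rewrite raddf_sum /=.
have E k' : (<< f@_k * g@_k' *g (k + k')%R >> : laurent)@_m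
    = if k' == m - k then f@_k * g@_k' else 0.
  rewrite mcoeffU eq_sym (eq_sym k') subr_eq [k + k']addrC.
  by case: eqP.
rewrite (eq_bigr _ (fun k' _ => E k')).
case: (msuppP g (m - k)) => [mg|mg].
  rewrite (big_fsetD1 (m - k)) //= eqxx big1_fset ?addr0 // => k'.
  by rewrite in_fsetD1 => /andP[/negbTE->].
rewrite mulr0 big1_fset // => k' k'g _.
by case: eqP k'g => // ->; rewrite (negbTE mg).
Qed.

Lemma laurent_top f : f != 0 ->
  exists2 a : int, f@_a != 0 & forall k, a < k -> f@_k = 0.
Proof.
move=> f0.
have [k0 k0P] : exists k, k \in msupp f.
  have [|[k kf]] := fset_0Vmem (msupp f); last by exists k.
  move=> s0; case/eqP: f0; apply/malgP => k.
  by rewrite mcoeff0 mcoeff_outdom // s0.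
pose a := [arg max_(i > [` k0P]) (val i : int)]%O.
exists (val a); first by rewrite mcoeff_neq0 (valP a).
move=> k; rewrite /a; case: arg_maxP => //= i _ im ik.
apply/eqP; rewrite mcoeff_eq0; apply/negP => kf.
by have := im [` kf] isT; rewrite /= leNgt ik.
Qed.

(* No zero divisors: a quotient of Laurent polynomials, when it exists, is
   determined by q * g = f. *)
Lemma laurent_mulf_eq0 f g : (f * g == 0) = (f == 0) || (g == 0).
Proof.
have [->|f0 /=] := eqVneq f 0; first by rewrite mul0r eqxx.
have [->|g0 /=] := eqVneq g 0; first by rewrite mulr0 eqxx.
have [a fa ltf] := laurent_top f0; have [b gb ltg] := laurent_top g0.
apply/negP => /eqP /malgP /(_ (a + b)%R) /eqP.
rewrite mcoeff0 laurent_coeffM (big_fsetD1 a) /=; last by rewrite -mcoeff_neq0.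
rewrite big1_fset ?addr0 => [|k].
  by rewrite (addrC a) addrK mulf_eq0 (negbTE fa) (negbTE gb).
rewrite in_fsetD1 => /andP[ka _] _; have [kla|lak|ek] := ltgtP k a.
- rewrite [g@_ _]ltg ?mulr0 // -addrA (addrC b) addrA.
  by rewrite ltrDr subr_gt0.
- by rewrite ltf ?mul0r.
- by rewrite ek eqxx in ka.
Qed.

Lemma laurent_mulIf g : g != 0 -> injective ( *%R^~ g : laurent -> laurent).
Proof.
move=> g0 f h /eqP; rewrite -subr_eq0 -mulrBl laurent_mulf_eq0 (negbTE g0) orbF.
by rewrite subr_eq0 => /eqP.
Qed.

End LaurentTheory.

Definition zeta : laurent := << 1 *g 1%R >>.

(* f(zeta^d), for any integer d *)
Definition lcomp (d : int) (f : laurent) : laurent :=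
  \sum_(k <- msupp f) << f@_k *g (d * k)%R >>.

Definition lsymmetric (f : laurent) : Prop := lcomp (-1) f = f.

Definition ldivides (g f : laurent) : Prop := exists h : laurent, f = h * g.

Definition Phi (l : nat) : laurent := \sum_(i < l) zeta ^+ i.

(* Main.v *)
Require Import Defs.
From mathcomp Require Import all_boot all_order all_algebra.
From mathcomp Require Import finmap.
From mathcomp.multinomials Require Import monalg.
From mathcomp Require Import zify ring.
Import Order.TTheory GRing.Theory Num.Theory.
Local Open Scope ring_scope.

(** Divide by the centred polynomial
      Psi = zeta^(1-l) Phi_l(zeta^2)
          = zeta^(1-l) + zeta^(3-l) + ... + zeta^(l-1)
    instead of Phi_l(zeta^2): the quotient q = f / Psi is the one in the
    statement.  As Psi and f are invariant under the ring automorphism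
    zeta |-> zeta^-1, so is q, because the Laurent polynomials form a domain
    ([lsymmetric_divr]).

    The sum Psi is geometric of ratio zeta^2, so
      (zeta^-1 - zeta) Psi = zeta^-l - zeta^l    ([lPsi_telescope]).
    Multiplying by q and comparing coefficients gives
      f_(m-1) - f_(m+1) = q_(m-l) - q_(m+l),
    and the hypothesis on f becomes q_(k+2l) <= q_k for all k >= 1 - l.
    Along the progression k, k + 2l, k + 4l, ... the coefficients of q thus
    decrease and are eventually 0, so that q_k >= 0 for k >= 1 - l
    ([laurent_coeff_ge0]).  Since 1 - l <= 0, this covers all k >= 0, and
    symmetry gives the negative k. *)

Definition lmonom (k : int) : laurent := << 1 *g k >>.

Lemma lmonomD (j k : int) : lmonom (j + k) = lmonom j * lmonom k.
Proof. by rewrite /lmonom laurentUM mulr1. Qed.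

Lemma zetaX (n : nat) : zeta ^+ n = lmonom n%:Z.
Proof. by elim: n => [|n IHn] //; rewrite exprS IHn intS lmonomD. Qed.

Lemma lmonomM_coeff (k m : int) (f : laurent) :
  (lmonom k * f)@_m = f@_(m - k)%R.
Proof.
rewrite laurent_coeffM msuppU oner_eq0 big_seq_fset1.
by rewrite mcoeffUU mul1r.
Qed.

(** Summing over any finite set that contains the support makes additivity
    of the substitution a termwise statement. *)
Lemma lcompw (D : {fset int}) (d : int) (f : laurent) :
  (msupp f `<=` D)%fset ->
  lcomp d f = \sum_(k <- D) << f@_k *g (d * k)%R >>.
Proof.
move=> sfD; apply: (big_fset_incl _ sfD) => k _ /mcoeff_outdom ->.
by rewrite monalgU0.
Qed.

Lemma lcompD (d : int) : {morph lcomp d : f g / f + g}.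
Proof.
move=> f g; rewrite (lcompw _ d _ (msuppD_le f g)).
rewrite (lcompw _ d _ (fsubsetUl _ (msupp g))).
rewrite (lcompw _ d _ (fsubsetUr (msupp f) _)) -big_split /=.
by apply: eq_bigr => k _; rewrite mcoeffD monalgUD.
Qed.

Lemma lcomp0 (d : int) : lcomp d 0 = 0.
Proof. by rewrite /lcomp msupp0 big_seq_fset0. Qed.

Lemma lcomp_sum (d : int) (I : Type) (r : seq I) (F : I -> laurent) :
  lcomp d (\sum_(i <- r) F i) = \sum_(i <- r) lcomp d (F i).
Proof. exact: (big_morph (lcomp d) (lcompD d) (lcomp0 d)). Qed.

Lemma lcompU (d : int) (c : rat) (k : int) :
  lcomp d << c *g k >> = << c *g (d * k)%R >>.
Proof. by rewrite (lcompw _ d _ msuppU_le) big_seq_fset1 mcoeffUU. Qed.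

Lemma lcompM (d : int) : {morph lcomp d : f g / f * g}.
Proof.
move=> f g.
(* Both sums are restated in the additive structure of [laurent]: they unfold
   to sums in the convertible structure of [{malg rat[int]}]. *)
have ME : f * g = \sum_(j <- msupp f) \sum_(k <- msupp g)
    (<< f@_j * g@_k *g (j + k)%R >> : laurent) by [].
have lcompE h : lcomp d h
    = \sum_(k <- msupp h) (<< h@_k *g (d * k)%R >> : laurent) by [].
rewrite ME lcomp_sum !lcompE mulr_suml; apply: eq_bigr => j _.
rewrite mulr_sumr lcomp_sum; apply: eq_bigr => k _.
by rewrite lcompU laurentUM mulrDr.
Qed.

Lemma lcompN1_coeff (f : laurent) (m : int) : (lcomp (-1) f)@_m = f@_(- m)%R.
Proof.
rewrite /lcomp raddf_sum /=.
have E k : (<< f@_k *g (-1 * k)%R >> : laurent)@_m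
    = if k == - m then f@_k else 0.
  by rewrite mcoeffU mulN1r eqr_oppLR; case: eqP.
rewrite (eq_bigr _ (fun k _ => E k)); case: (msuppP f (- m)) => [mf|mf].
  rewrite (big_fsetD1 (- m)) //= eqxx big1_fset ?addr0 // => k.
  by rewrite in_fsetD1 => /andP[/negbTE->].
rewrite big1_fset // => k kf _.
by case: eqP kf => // ->; rewrite (negbTE mf).
Qed.

Lemma lsymmetric_coeffN (f : laurent) (m : int) :
  lsymmetric f -> f@_(- m)%R = f@_m.
Proof. by move=> sf; rewrite -lcompN1_coeff sf. Qed.

(** zeta |-> zeta^-1 sends q to another quotient of q g by g, and quotients
    are unique in a domain. *)
Lemma lsymmetric_divr (q g : laurent) :
  g != 0 -> lsymmetric g -> lsymmetric (q * g) -> lsymmetric q.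
Proof.
move=> g0 sg; rewrite /lsymmetric lcompM sg.
exact: laurent_mulIf.
Qed.

Definition lPsi (l : nat) : laurent :=
  \sum_(i < l) lmonom (2 * i%:Z - l.-1%:Z).

Lemma lcomp2_Phi (l : nat) : lcomp 2 (Phi l) = zeta ^+ l.-1 * lPsi l.
Proof.
rewrite lcomp_sum zetaX mulr_sumr; apply: eq_bigr => i _.
by rewrite zetaX lcompU -lmonomD addrC subrK.
Qed.

Lemma lPsi_sym (l : nat) : lsymmetric (lPsi l).
Proof.
rewrite /lsymmetric lcomp_sum [RHS](reindex_inj rev_ord_inj) /=.
apply: eq_bigr => i _; rewrite lcompU /lmonom; congr << _ *g _ >>.
by have := ltn_ord i; lia.
Qed.

Lemma lPsi_telescope (l : nat) :
  (lmonom (-1) - lmonom 1) * lPsi l = lmonom (- l%:Z) - lmonom l%:Z.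
Proof.
pose u (i : nat) := lmonom (2 * i%:Z - l%:Z).
rewrite mulr_sumr (eq_bigr (fun i : 'I_l => u i - u i.+1)) => [|i _]; last first.
  have := ltn_ord i => il; rewrite mulrBl -!lmonomD.
  by congr (lmonom _ - lmonom _); lia.
rewrite -(big_mkord predT (fun i => u i - u i.+1)).
rewrite (telescope_sumr_eq (fun i => - u i)) // => [|i _]; last first.
  by rewrite opprK addrC.
by rewrite opprK addrC /u; congr (lmonom _ - lmonom _); lia.
Qed.

(** The right-hand side of the telescoped identity is nonzero. *)
Lemma lPsi_neq0 (l : nat) : (0 < l)%N -> lPsi l != 0.
Proof.
move=> l0; apply/eqP => P0; have := lPsi_telescope l.
rewrite P0 mulr0 => /(congr1 (mcoeff l%:Z)) /eqP.
rewrite mcoeff0 mcoeffB !mcoeffU eqxx.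
by have -> : (- l%:Z == l%:Z) = false by lia.
Qed.

(** Multiplied by zeta^-1 - zeta, the polynomial Psi keeps only two terms, so
    a difference of two coefficients of q Psi involves only two coefficients
    of q. *)
Lemma coeff_divPsi (l : nat) (q : laurent) (m : int) :
  (q * lPsi l)@_(m - 1)%R - (q * lPsi l)@_(m + 1)%R
    = q@_(m - l%:Z)%R - q@_(m + l%:Z)%R.
Proof.
have E : (lmonom (- l%:Z) - lmonom l%:Z) * q
    = (lmonom (-1) - lmonom 1) * (q * lPsi l).
  by rewrite -lPsi_telescope mulrAC mulrA.
have coeffB j k (g : laurent) :
    ((lmonom j - lmonom k) * g)@_m = g@_(m - j)%R - g@_(m - k)%R.
  by rewrite mulrBl mcoeffB; congr (_ - _); apply: lmonomM_coeff.
have := congr1 (mcoeff m) E; rewrite (coeffB _ _ q) (coeffB _ _ (q * lPsi l)).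
rewrite !opprK => Em.
by rewrite -[LHS]opprB -[RHS]opprB -Em.
Qed.

(** A sequence that decreases along an arithmetic progression and is
    eventually 0 is non-negative on it. *)
Lemma laurent_coeff_ge0 (q : laurent) (a d : int) :
  0 < d -> (forall k, a <= k -> q@_(k + d)%R <= q@_k) ->
  forall k, a <= k -> 0 <= q@_k.
Proof.
move=> d0 qle k ak.
have [N qN] : exists N : int, forall j, N < j -> q@_j = 0.
  have [->|/laurent_top[N _ qN]] := eqVneq q 0; last by exists N.
  by exists 0 => j _; rewrite mcoeff0.
have qlen n : q@_(k + d * n%:Z)%R <= q@_k.
  elim: n => [|n IHn]; first by rewrite mulr0 addr0.
  have -> : k + d * n.+1%:Z = k + d * n%:Z + d by lia.
  apply: le_trans (qle _ _) IHn.
  by rewrite (le_trans ak) // lerDl mulr_ge0 // ltW.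
have [n Nkn] : exists n : nat, N < k + n%:Z by exists (absz (N - k)).+1; lia.
have dn : n%:Z <= d * n%:Z by rewrite ler_peMl.
by rewrite -(qN (k + d * n%:Z)) // (lt_le_trans Nkn) // lerD2l.
Qed.

Theorem lemma3p2 (l : nat) (f : laurent) :
  prime l ->
  lsymmetric f ->
  ldivides (lcomp 2 (Phi l)) f ->
  (forall m : int, 1 <= m -> f@_(m + 1)%R <= f@_(m - 1)%R) ->
  exists q : laurent,
    [/\ q * lcomp 2 (Phi l) = zeta ^+ l.-1 * f,
        lsymmetric q
      & forall m : int, 0 <= q@_m].
Proof.
move=> /prime_gt0 l0 sf [h fE] fle.
pose q : laurent := zeta ^+ l.-1 * h.
have qPsi : q * lPsi l = f by rewrite fE lcomp2_Phi /q mulrAC mulrC.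
have sq : lsymmetric q.
  by apply: (lsymmetric_divr _ _ (lPsi_neq0 l l0) (lPsi_sym l)); rewrite qPsi.
exists q; split; [|exact: sq|move=> m].
  by rewrite fE /q -mulrA.
(* The hypothesis on f at m = k + l, which is at least 1 for k >= 1 - l. *)
have q_decr k : 1 - l%:Z <= k -> q@_(k + 2 * l%:Z)%R <= q@_k.
  move=> lk; have := coeff_divPsi l q (k + l%:Z); rewrite qPsi addrK.
  have -> : k + l%:Z + l%:Z = k + 2 * l%:Z by ring.
  by rewrite -subr_ge0 => <-; rewrite subr_ge0; apply: fle; lia.
have q_ge0 k : 0 <= k -> 0 <= q@_k.
  by move=> k0; apply: (laurent_coeff_ge0 _ _ _ _ q_decr); lia.
have [/q_ge0 //|m0] := leP 0 m.
by rewrite -lsymmetric_coeffN //; apply: q_ge0; rewrite oppr_ge0 ltW.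
Qed.
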